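(* Let $R=\mathbb K[x_0,\dots,x_n]$ with $\mathbb K$ a field (i.e. $A=\mathbb K$). Let $J\subset R$ be a quasi-stable ideal, and let $I\subset R$ be an ideal generated by a $J$-marked basis $F$. If the $J$-resolution of $I$ is minimal, then $I$ is componentwise linear.
   Context: $R$ has the standard grading and $x_0<\dots<x_n$. A graded ideal $I$ is componentwise linear if, for every degree $d\ge0$, the ideal $(I_d)$ generated by the degree-$d$ component of $I$ has a linear resolution, i.e. its only possibly non-vanishing graded Betti numbers are $\beta_{i,i+d}$, $i=0,1,\dots$. A term of $R$ is a monomial $x^\alpha$; for $x^\alpha\neq1$, $\min(x^\alpha)$ is the smallest variable dividing it. Variables $x_i>\min(x^\alpha)$ are non-multiplicative for $x^\alpha$ (the term $1$ has no non-multiplicative variables). The same notions apply to terms $x^\alpha\mathbf e_k$ of a graded free module $\bigoplus_kR(-d_k)\mathbf e_k$ (using $x^\alpha$). For a monomial submodule (or ideal) $U$, $\mathcal N(U)$ is the set of terms not in $U$. Pommaret cone: $\mathcal C(x^\alpha)=\{x^\delta x^\alpha\mid\delta_i=0\ \forall x_i>\min(x^\alpha)\}$ for $x^\alpha\neq 1$, $\mathcal C(1)=$ all terms, $\mathcal C(x^\alpha\mathbf e_k)=\mathcal C(x^\alpha)\mathbf e_k$. A Pommaret basis of $U$ is a set of terms generating $U$ whose cones partition the set of terms of $U$; it is unique if it exists, denoted $\mathcal P_U$. $U$ is quasi-stable if it has a finite Pommaret basis, stable if moreover $\mathcal P_U$ is its minimal monomial generating set. A $U$-marked set is a finite set $F=\{f_\tau\}_{\tau\in\mathcal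 P_U}$ of homogeneous elements such that $\tau$ has coefficient $1$ in $f_\tau$ and the support of $f_\tau-\tau$ is contained in $\mathcal N(U)$. It is a $U$-marked basis if, for all $s$, the degree-$s$ part of the ambient free module is $(F)_s\oplus\langle\mathcal N(U)_s\rangle_{\mathbb K}$. Then each $f\in(F)$ has a unique writing $f=\sum_{\tau\in\mathcal P_U} P_\tau f_\tau$ with $P_\tau\in R$ and all terms of $P_\tau\tau$ in $\mathcal C(\tau)$. $U$-resolution of $M=(F)$: let $P_0=\bigoplus_{\tau\in\mathcal P_U}R(-\deg\tau)\mathbf f_\tau$ and $\partial_0(\mathbf f_\tau)=f_\tau$. For $\tau\in\mathcal P_U$ and $x_i$ non-multiplicative for $\tau$, the fundamental syzygy is $S_{i,\tau}=x_i\mathbf f_\tau-\sum P_\sigma\mathbf f_\sigma$, where $x_if_\tau=\sum P_\sigma f_\sigma$ is the unique writing. The set $F^{\partial_1}$ of fundamental syzygies is a marked basis (head term of $S_{i,\tau}$: $x_i\mathbf f_\tau$) of $\ker\partial_0$ over the stable module with Pommaret basis $\{x_i\mathbf f_\tau\mid x_i\text{ non-multiplicative for }\tau\}$. Iterating (known), $F^{\partial_t}$, the set of fundamental syzygies of $F^{\partial_{t-1}}$ (with $F^{\partial_0}=F$), is a marked basis of $\ker\partial_{t-1}$ over a stable module, and $\partial_t:P_t\to P_{t-1}$ is the homomorphism whose matrix has the elements of $F^{\partial_t}$ as columns. The resulting finite graded free resolution is the $U$-resolution of $M$ (here $U=J$, $M=I$). It is minimal if no matrix entry of $\partial_t$,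 $t\ge1$, is a non-zero constant. *)

(* Defs.v *)
From HB Require Import structures.
From mathcomp Require Import all_boot all_order all_algebra.
From mathcomp Require Import finmap.
From mathcomp Require Export mpoly.
From Stdlib Require Import ClassicalEpsilon.

Set Implicit Arguments.
Unset Strict Implicit.
Unset Printing Implicit Defensive.

Import GRing.Theory.

Local Open Scope ring_scope.

(* The polynomial ring K[x_0, ..., x_n] is {mpoly K[n.+1]}; its terms are the
   elements of 'X_{1..n.+1}, and x_0 < ... < x_n is the order on 'I_n.+1.
   Ideals are Prop-valued predicates on polynomials. *)

Section Terms.
Variable n : nat.
Implicit Types (a m : 'X_{1..n.+1}) (i : 'I_n.+1).

(* None exactly when the term is 1. *)
Definition min_var a : option 'I_n.+1 :=
  [pick i | (a i != 0%N) && [forall j : 'I_n.+1, (j < i)%N ==> (a j == 0%N)]].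

Definition nonmult a i : bool :=
  if min_var a is Some k then (k < i)%N else false.

Definition in_cone a m : Prop :=
  exists delta : 'X_{1..n.+1},
    (forall i, nonmult a i -> delta i = 0%N) /\ m = (delta + a)%MM.

End Terms.

Section Ideals.
Variables (K : fieldType) (n : nat).
Local Notation R := {mpoly K[n.+1]}.

Definition ideal_gen (S : R -> Prop) (f : R) : Prop :=
  exists s : seq (R * R),
    (forall q, q \in s -> S q.2) /\ f = \sum_(q <- s) q.1 * q.2.

(* The first clause makes J the monomial ideal generated by P; the other two
   say that the cones of the elements of P partition the terms of J. *)
Definition pommaret_basis (J : R -> Prop) (P : {fset 'X_{1..n.+1}}) : Prop :=
  [/\ forall f, J f <-> ideal_gen (fun g => exists2 a, a \in P & g = 'X_[a]) f,
      forall m, J 'X_[m] <-> exists2 a, a \in P & in_cone a m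
    & forall a b m, a \in P -> b \in P -> in_cone a m -> in_cone b m -> a = b].

Definition quasi_stable (J : R -> Prop) : Prop := exists P, pommaret_basis J P.

Definition supp_outside (J : R -> Prop) (f : R) : Prop :=
  forall m, m \in msupp f -> ~ J 'X_[m].

Definition marked_set (J : R -> Prop) (P : {fset 'X_{1..n.+1}}) (F : P -> R) :
    Prop :=
  forall a : P,
    [/\ exists d, F a \is d.-homog,
        (F a)@_(val a) = 1
      & supp_outside J (F a - 'X_[val a])].

Definition ideal_of (P : {fset 'X_{1..n.+1}}) (F : P -> R) : R -> Prop :=
  ideal_gen (fun g => exists a : P, g = F a).

(* The last two clauses say that R_s is the direct sum of (F)_s and of the span
   of the terms of degree s outside J: sum, then trivial intersection. *)
Definition marked_basis (J : R -> Prop) (P : {fset 'X_{1..n.+1}}) (F : P -> R) :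
    Prop :=
  [/\ marked_set J F,
      forall s (f : R), f \is s.-homog ->
        exists g h : R,
          [/\ f = g + h, ideal_of F g, g \is s.-homog,
              h \is s.-homog & supp_outside J h]
    & forall s (f : R), f \is s.-homog ->
        ideal_of F f -> supp_outside J f -> f = 0].

End Ideals.

Section FreeModules.
Variables (K : fieldType) (n : nat).
Local Notation R := {mpoly K[n.+1]}.

(* {ffun T -> R} is the free module with basis T. *)
Definition free_scale (T : finType) (p : R) (v : {ffun T -> R}) :
    {ffun T -> R} := [ffun t => p * v t].

Definition free_basis (T : finType) (t0 : T) : {ffun T -> R} :=
  [ffun t => (t == t0)%:R].

(* The homomorphism mapping the basis element s to A s. *)
Definition free_map (S T : finType) (A : S -> {ffun T -> R})
    (v : {ffun S -> R}) : {ffun T -> R} := [ffun t => \sum_s v s * A s t].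

(* Elements of the free module with basis [amb], each with its head term
   (x^a, e_k) representing x^a e_k. *)
Record marked_family := MarkedFamily {
  amb : finType;
  idx : finType;
  head : idx -> 'X_{1..n.+1} * amb;
  elt : idx -> {ffun amb -> R} }.

(* f = \sum_s Q_s f_s with all terms of Q_s * (head s) in the cone of head s. *)
Definition is_writing (M : marked_family) (f : {ffun amb M -> R})
    (Q : {ffun idx M -> R}) : Prop :=
  f = free_map (@elt M) Q /\
  forall s m, m \in msupp (Q s) -> in_cone (head s).1 (m + (head s).1)%MM.

(* For a marked basis the writing exists and is unique, so that epsilon returns
   that one. *)
Definition writing (M : marked_family) (f : {ffun amb M -> R}) :
    {ffun idx M -> R} :=
  epsilon (inhabits 0) (@is_writing M f).

Definition syz_idx (M : marked_family) : finType :=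
  {q : idx M * 'I_n.+1 | nonmult (head q.1).1 q.2}.

Definition syz_head (M : marked_family) (q : syz_idx M) :
    'X_{1..n.+1} * idx M := (U_((val q).2)%MM, (val q).1).

Definition fund_syz (M : marked_family) (q : syz_idx M) : {ffun idx M -> R} :=
  let k := (val q).1 in let i := (val q).2 in
  free_scale 'X_i (free_basis k) - writing (free_scale 'X_i (elt k)).

Definition syz_family (M : marked_family) : marked_family :=
  {| amb := idx M; idx := syz_idx M;
     head := @syz_head M; elt := @fund_syz M |}.

Definition family_of (P : {fset 'X_{1..n.+1}}) (F : P -> R) : marked_family :=
  {| amb := unit; idx := P;
     head := fun a => (val a, tt); elt := fun a => [ffun=> F a] |}.

(* The t-th differential of the U-resolution maps the basis element s of
   P_t = {ffun idx (U_res F t) -> R} to elt s, an element of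
   {ffun amb (U_res F t) -> R}; for t > 0 the latter is P_(t - 1). *)
Definition U_res (P : {fset 'X_{1..n.+1}}) (F : P -> R) (t : nat) :
    marked_family := iter t syz_family (family_of F).

Definition U_res_minimal (P : {fset 'X_{1..n.+1}}) (F : P -> R) : Prop :=
  forall t, (0 < t)%N ->
  forall (s : idx (U_res F t)) (k : amb (U_res F t)) (c : K),
    c != 0 -> elt s k <> c%:MP.

(* Complexes ... -> G_1 -> G_0 -> R of free modules, G_i having the basis
   [gbasis i], whose elements have the degrees [gdeg i]. *)
Record free_complex := FreeComplex {
  gbasis : nat -> finType;
  gdeg : forall i, gbasis i -> nat;
  gaug : gbasis 0 -> R;
  gdiff : forall i, gbasis i.+1 -> {ffun gbasis i -> R} }.

Definition graded_complex (C : free_complex) : Prop :=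
  (forall b : gbasis C 0, gaug b \is (gdeg b).-homog) /\
  (forall i (b : gbasis C i.+1) (a : gbasis C i) m,
     m \in msupp (gdiff b a) -> (mdeg m + gdeg a)%N = gdeg b).

Definition resolves (C : free_complex) (I : R -> Prop) : Prop :=
  [/\ forall f, I f <->
        exists v : {ffun gbasis C 0 -> R}, f = \sum_b v b * gaug b,
      forall v : {ffun gbasis C 0 -> R}, \sum_b v b * gaug b = 0 <->
        exists w, v = free_map (@gdiff C 0) w
    & forall i (v : {ffun gbasis C i.+1 -> R}),
        free_map (@gdiff C i) v = 0 <->
        exists w, v = free_map (@gdiff C i.+1) w].

Definition minimal_complex (C : free_complex) : Prop :=
  forall i (b : gbasis C i.+1) (a : gbasis C i) (c : K),
    c != 0 -> gdiff b a <> c%:MP.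

(* beta_{i,j} of an ideal, read off from a minimal graded free resolution C. *)
Definition betti (C : free_complex) (i j : nat) : nat :=
  #|[pred b : gbasis C i | gdeg b == j]|.

Definition has_linear_resolution (d : nat) (I : R -> Prop) : Prop :=
  exists C : free_complex,
    [/\ graded_complex C, resolves C I, minimal_complex C
      & forall i j, betti C i j <> 0%N -> j = (i + d)%N].

Definition componentwise_linear (I : R -> Prop) : Prop :=
  forall d, has_linear_resolution d (ideal_gen (fun f => I f /\ f \is d.-homog)).

End FreeModules.

(* Main.v *)
Require Import Defs.
From mathcomp Require Import all_boot all_order all_algebra.
From mathcomp Require Import finmap.
From mathcomp Require Import zify.
From Stdlib Require Import Classical ClassicalEpsilon.

Set Implicit Arguments.
Unset Strict Implicit.
Unset Printing Implicit Defensive.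

Import GRing.Theory.
Local Open Scope ring_scope.

(** Call x_j multiplicative for a generator of level k when j <= k; for a marked
    basis the level of f_tau is the index of min(tau).

    The coefficients of the f_sigma, sigma <> tau, in the writing of x_i f_tau, for
    x_i non-multiplicative, are up to sign entries of the first differential.
    When the resolution is minimal none of them is a non-zero constant, so by
    homogeneity only f_sigma with deg sigma <= deg tau occur ([marked_relP]).
    Hence the f_sigma of degree at most d are closed among themselves under
    rewriting non-multiplicative products, and every multiple of one of them, of
    whatever degree, has a writing that involves only them
    ([degree_bounded_span]).

    Fix d.  The products x^delta f_tau of degree d with x^delta multiplicative
    span I_d.  Give such a product the level of min(x^delta tau).  Multiplied by
    a variable it is a sum of P_sigma f_sigma with deg sigma <= d, so each
    term of P_sigma has positive degree; splitting off the smallest variable of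
    that term leaves a multiplicative linear form times products of degree d.
    With this the products form a linear system ([component_linear]):
    non-multiplicative multiples of generators are combinations with
    multiplicative linear coefficients, and there is no non-trivial relation with
    multiplicative coefficients.

    A linear system always has a linear resolution.  Its kernel is generated by
    the elements x_i e_s minus the coefficients of x_i g_s, because a term m e_s
    can be reduced by replacing the largest variable x_i of m, when it is
    non-multiplicative, by terms in smaller variables or by terms that are
    already multiplicative ([top_variable_reduction]).  These syzygies, with level
    i for the one of x_i e_s, again form a linear system ([syz_system_linear]),
    and one iterates.

    The independence statements all follow one pattern
    ([triangular_independent]): head terms are distinct, and whenever the tail of
    one product meets the head of another, the first product is heavier, so a
    heaviest term of a relation cannot be cancelled. *)

(** * Combinations with prescribed terms in the coefficients *)

Section LinearResolutions.
Variables (K : fieldType) (n : nat).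
Local Notation R := {mpoly K[n.+1]}.
Local Notation mon := 'X_{1..n.+1}.
Local Notation e_ := (@free_basis K n _).

Section FreeMap.
Variables (T B : finType) (g : T -> {ffun B -> R}).
Implicit Types (v w : {ffun T -> R}) (p : R) (c : K).

Lemma free_mapD v w : free_map g (v + w) = free_map g v + free_map g w.
Proof.
apply/ffunP=> b; rewrite !ffunE -big_split /=.
by apply: eq_bigr => t _; rewrite ffunE mulrDl.
Qed.

Lemma free_mapN v : free_map g (- v) = - free_map g v.
Proof.
apply/ffunP=> b; rewrite !ffunE -sumrN.
by apply: eq_bigr => t _; rewrite ffunE mulNr.
Qed.

Lemma free_mapZ c v : free_map g (c *: v) = c *: free_map g v.
Proof.
apply/ffunP=> b; rewrite !ffunE scaler_sumr.
by apply: eq_bigr => t _; rewrite ffunE scalerAl.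
Qed.

Lemma free_map_scale p v :
  free_map g (free_scale p v) = free_scale p (free_map g v).
Proof.
apply/ffunP=> b; rewrite !ffunE mulr_sumr.
by apply: eq_bigr => t _; rewrite ffunE mulrA.
Qed.

Lemma free_map0 : free_map g 0 = 0.
Proof. by apply/ffunP=> b; rewrite !ffunE big1 // => t _; rewrite ffunE mul0r. Qed.

Lemma free_map_basis t : free_map g (e_ t) = g t.
Proof.
apply/ffunP=> b; rewrite !ffunE (bigD1 t) //= ffunE eqxx mul1r.
by rewrite big1 ?addr0 // => s /negPf st; rewrite ffunE st mul0r.
Qed.

End FreeMap.

Lemma eq_free_map (T B : finType) (g h : T -> {ffun B -> R}) v :
  g =1 h -> free_map g v = free_map h v.
Proof.
move=> gh; apply/ffunP=> b; rewrite !ffunE.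
by apply: eq_bigr => t _; rewrite gh.
Qed.

Lemma free_map_id (T : finType) (v : {ffun T -> R}) :
  free_map (fun t => e_ t) v = v.
Proof.
apply/ffunP=> s; rewrite ffunE (bigD1 s) //= ffunE eqxx mulr1.
by rewrite big1 ?addr0 // => t ts; rewrite ffunE eq_sym (negPf ts) mulr0.
Qed.

Lemma free_scaleM (T : finType) (p q : R) (v : {ffun T -> R}) :
  free_scale p (free_scale q v) = free_scale (p * q) v.
Proof. by apply/ffunP=> t; rewrite !ffunE mulrA. Qed.

Lemma free_scaleB (T : finType) (p : R) (v w : {ffun T -> R}) :
  free_scale p (v - w) = free_scale p v - free_scale p w.
Proof. by apply/ffunP=> t; rewrite !ffunE mulrBr. Qed.

Lemma free_scale1 (T : finType) (v : {ffun T -> R}) : free_scale 1 v = v.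
Proof. by apply/ffunP=> t; rewrite !ffunE mul1r. Qed.

Lemma free_map_comp (S T B : finType) (h : S -> {ffun T -> R})
    (g : T -> {ffun B -> R}) (v : {ffun S -> R}) :
  free_map g (free_map h v) = free_map (fun s => free_map g (h s)) v.
Proof.
apply/ffunP=> b; rewrite !ffunE.
under eq_bigr => t _ do rewrite ffunE mulr_suml.
rewrite exchange_big /=; apply: eq_bigr => s _; rewrite ffunE mulr_sumr.
by apply: eq_bigr => t _; rewrite mulrA.
Qed.

Lemma free_map_ker (S T B : finType) (h : S -> {ffun T -> R})
    (g : T -> {ffun B -> R}) (v : {ffun S -> R}) :
  (forall s, free_map g (h s) = 0) -> free_map g (free_map h v) = 0.
Proof.
move=> gh0; rewrite free_map_comp; apply/ffunP=> b; rewrite !ffunE big1 // => s _.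
by rewrite gh0 ffunE mulr0.
Qed.

(** [A t] is the set of terms that a coefficient of the basis element t may
    contain. *)
Definition supported (T : finType) (A : T -> mon -> Prop) (v : {ffun T -> R}) :
    Prop := forall t m, m \in msupp (v t) -> A t m.

Definition spanned (T B : finType) (g : T -> {ffun B -> R})
    (A : T -> mon -> Prop) (f : {ffun B -> R}) : Prop :=
  exists2 v : {ffun T -> R}, supported A v & f = free_map g v.

Section Spanned.
Variables (T B : finType) (g : T -> {ffun B -> R}) (A : T -> mon -> Prop).
Implicit Types f h : {ffun B -> R}.

Lemma spanned0 : spanned g A 0.
Proof. by exists 0; rewrite ?free_map0 // => t m; rewrite ffunE msupp0. Qed.

Lemma spannedD f h : spanned g A f -> spanned g A h -> spanned g A (f + h).
Proof.
move=> [v Av ->] [w Aw ->]; exists (v + w); last by rewrite free_mapD.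
move=> t m; rewrite ffunE => /msuppD_le; rewrite mem_cat.
by case/orP; [exact: Av|exact: Aw].
Qed.

Lemma spannedZ c f : spanned g A f -> spanned g A (c *: f).
Proof.
move=> [v Av ->]; exists (c *: v); last by rewrite free_mapZ.
by move=> t m; rewrite ffunE => /msuppZ_le; exact: Av.
Qed.

Lemma spanned_big (I : Type) (r : seq I) (Q : pred I) (F : I -> {ffun B -> R}) :
  (forall i, Q i -> spanned g A (F i)) -> spanned g A (\sum_(i <- r | Q i) F i).
Proof. by move=> AF; elim/big_ind: _ => //; [exact: spanned0|exact: spannedD]. Qed.

Lemma spanned_monom t m : A t m -> spanned g A (free_scale 'X_[m] (g t)).
Proof.
move=> Atm; exists (free_scale 'X_[m] (e_ t)); last first.
  by rewrite free_map_scale free_map_basis.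
move=> s k; rewrite !ffunE; case: eqP => [->|_]; last by rewrite mulr0 msupp0.
by rewrite mulr1 => /mem_msuppXP <-.
Qed.

End Spanned.

(** Only the products of one term and one generator have to be rewritten: [spanned]
    is closed under linear combinations over K.  All rewriting below goes
    through this. *)
Lemma spanned_trans (S T B : finType) (h : S -> {ffun B -> R})
    (g : T -> {ffun B -> R}) (A : T -> mon -> Prop) (C : S -> mon -> Prop) f :
  spanned g A f ->
  (forall t m, A t m -> spanned h C (free_scale 'X_[m] (g t))) ->
  spanned h C f.
Proof.
move=> [v Av ->] AC.
have -> : free_map g v =
    \sum_t \sum_(m <- msupp (v t)) (v t)@_m *: free_scale 'X_[m] (g t).
  apply/ffunP=> b; rewrite ffunE sum_ffunE; apply: eq_bigr => t _.
  rewrite sum_ffunE {1}(mpolyE (v t)) mulr_suml.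
  by apply: eq_bigr => m _; rewrite !ffunE scalerAl.
apply: spanned_big => t _; rewrite big_seq; apply: spanned_big => m Am.
exact/spannedZ/AC/Av.
Qed.

(** Rewriting modulo something is spanning by the union of two families, one for
    the part rewritten to zero and one for the normal form. *)
Definition sum_family (T1 T2 B : finType) (g1 : T1 -> {ffun B -> R})
    (g2 : T2 -> {ffun B -> R}) (s : (T1 + T2)%type) : {ffun B -> R} :=
  match s with inl t => g1 t | inr t => g2 t end.

Definition sum_cond (T1 T2 : finType) (A1 : T1 -> mon -> Prop)
    (A2 : T2 -> mon -> Prop) (s : (T1 + T2)%type) : mon -> Prop :=
  match s with inl t => A1 t | inr t => A2 t end.

Lemma spanned_sum_family (T1 T2 B : finType) (g1 : T1 -> {ffun B -> R})
    (g2 : T2 -> {ffun B -> R}) A1 A2 f :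
  spanned (sum_family g1 g2) (sum_cond A1 A2) f ->
  exists f1 f2, [/\ f = f1 + f2, spanned g1 A1 f1 & spanned g2 A2 f2].
Proof.
move=> [v Av ->].
exists (free_map g1 [ffun t => v (inl t)]), (free_map g2 [ffun t => v (inr t)]).
split.
- apply/ffunP=> b; rewrite !ffunE big_sumType /=.
  by congr (_ + _); apply: eq_bigr => t _; rewrite ffunE.
- by exists [ffun t => v (inl t)] => // t m; rewrite ffunE => /Av.
- by exists [ffun t => v (inr t)] => // t m; rewrite ffunE => /Av.
Qed.

(** * Triangular families are independent *)

(** The supports are finite, so a weight that can always be increased has nothing
    to act on. *)
Lemma no_heaviest_term (T : finType) (wt : T -> mon -> nat) (v : {ffun T -> R}) :
  (forall t m, m \in msupp (v t) ->
     exists t' m', m' \in msupp (v t') /\ (wt t m < wt t' m')%N) ->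
  v = 0.
Proof.
move=> heavier.
pose b := \max_t \max_(m <- msupp (v t)) wt t m.
have le_b t m : m \in msupp (v t) -> (wt t m <= b)%N.
  move=> mt; apply: leq_trans (leq_bigmax t).
  exact: (leq_bigmax_seq (F := fun m => wt t m)).
have desc k t m : m \in msupp (v t) -> (wt t m + k <= b)%N.
  elim: k t m => [|k IHk] t m mt; first by rewrite addn0; exact: le_b.
  have [t' [m' [mt' lt_wt]]] := heavier t m mt.
  by have := IHk _ _ mt'; lia.
apply/ffunP=> t; rewrite ffunE; apply: msuppnil0.
case E: (msupp (v t)) => [//|m s].
have := desc b.+1 t m; rewrite E mem_head => /(_ isT); lia.
Qed.

(** The element g t is the head x^(hd t) e_(hb t) plus a tail.  Look at the
    coefficient of the head of a product in the relation: by the first condition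
    no other head contributes, so a tail does, and by the second it belongs to a
    heavier product. *)
Lemma triangular_independent (T B : finType) (g : T -> {ffun B -> R})
    (hd : T -> mon) (hb : T -> B) (wt : T -> mon -> nat) (v : {ffun T -> R}) :
  (forall t t' m m', m \in msupp (v t) -> m' \in msupp (v t') -> hb t = hb t' ->
     (m + hd t = m' + hd t')%MM -> t = t') ->
  (forall t t' m m' e, m \in msupp (v t) -> m' \in msupp (v t') ->
     e \in msupp (g t' (hb t) - (hb t == hb t')%:R * 'X_[hd t']) ->
     (m + hd t = m' + e)%MM -> (wt t m < wt t' m')%N) ->
  free_map g v = 0 -> v = 0.
Proof.
move=> disj tail gv0; apply: (no_heaviest_term (wt := wt)) => t m mt.
apply: NNPP => none.
have notail t' :
    (v t' * (g t' (hb t) - (hb t == hb t')%:R * 'X_[hd t']))@_(m + hd t) = 0.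
  apply: memN_msupp_eq0; apply/negP.
  move=> /msuppM_le /allpairsP[[m' e] /= [m't' e't' E]].
  by apply: none; exists t', m'; split=> //; apply: tail e't' E.
have := congr1 (fun f : {ffun B -> R} => (f (hb t))@_(m + hd t)) gv0.
rewrite !ffunE mcoeff0 raddf_sum /= (bigD1 t) //= big1 => [|t' t't].
  have := notail t; rewrite eqxx mul1r mulrBr mcoeffB => /eqP.
  rewrite subr_eq0 => /eqP ->; rewrite addr0 addmC mcoeffMX => /eqP.
  by rewrite mcoeff_eq0 mt.
have := notail t'; rewrite mulrBr mcoeffB => /eqP; rewrite subr_eq0 => /eqP ->.
case: eqP => [Eb|_]; last by rewrite mul0r mulr0 mcoeff0.
rewrite mul1r; apply: memN_msupp_eq0; apply/negP => /msuppM_le.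
move=> /allpairsP[[m' e] /= [m't' /mem_msuppXP <- E]].
by move: t't; rewrite (disj t t' m m') ?eqxx.
Qed.


(** * Reduction by the largest variable *)

Definition low (k : nat) (m : mon) : Prop :=
  forall j : 'I_n.+1, (k < j)%N -> m j = 0%N.

Lemma low_add k m m' : low k m -> low k m' -> low k (m + m')%MM.
Proof. by move=> mk mk' j kj; rewrite mnmDE mk ?mk'. Qed.

Lemma low_le k k' m : (k <= k')%N -> low k m -> low k' m.
Proof. by move=> kk' mk j k'j; apply: mk; lia. Qed.

Lemma subm_addU (m : mon) (i : 'I_n.+1) : (0 < m i)%N ->
  m = (m - U_(i) + U_(i))%MM.
Proof.
move=> mi; apply/mnmP => j; rewrite mnmDE mnmBE mnm1E.
by case: eqP => [<-|_] /=; lia.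
Qed.

Section Relations.
Variables (T : finType) (lev : T -> nat) (rel : T -> 'I_n.+1 -> {ffun T -> R}).

(** [rel s i] is meant to be the coefficient vector of x_i g_s when x_i is
    non-multiplicative for s, so that [rel_syz] are the induced syzygies of g. *)
Definition rel_idx : finType := {q : T * 'I_n.+1 | (lev q.1 < q.2)%N}.

Definition rel_syz (q : rel_idx) : {ffun T -> R} :=
  free_scale 'X_((val q).2) (e_ (val q).1) - rel (val q).1 (val q).2.

Hypothesis rel_low : forall s (i : 'I_n.+1), (lev s < i)%N ->
  supported (fun t => low (lev t)) (rel s i).

(** The set of terms A is arbitrary up to invariance under rewriting; it is where
    degrees and degree bounds are recorded, for the syzygy part f1 as well as for
    the normal form f2.  Termination: replacing the largest variable x_k of a
    term m e_s by a term p e_t either gives a multiplicative term, or p has only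
    variables of index at most the level of t, which is < k, and then the
    exponent of x_k has dropped. *)
Lemma top_variable_reduction (A : T -> mon -> Prop) (v : {ffun T -> R}) :
  (forall s (i : 'I_n.+1) (m : mon) t p, (lev s < i)%N -> A s (m + U_(i))%MM ->
     p \in msupp (rel s i t) -> A t (m + p)%MM) ->
  supported A v ->
  exists f1 f2, [/\ v = f1 + f2,
    spanned rel_syz
      (fun (q : rel_idx) m => low (val q).2 m /\ A (val q).1 (m + U_((val q).2))%MM) f1
    & spanned (fun t => e_ t) (fun t m => low (lev t) m /\ A t m) f2].
Proof.
move=> Acl Av; apply: spanned_sum_family.
have Av' : spanned (fun t => e_ t) A v by exists v; rewrite ?free_map_id.
apply: (spanned_trans Av') => {v Av Av'}.
suff red k s (m : mon) : (forall j : 'I_n.+1, (k <= j)%N -> m j = 0%N) -> A s m ->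
    spanned (sum_family rel_syz (fun t => e_ t)) (sum_cond
      (fun (q : rel_idx) m => low (val q).2 m /\ A (val q).1 (m + U_((val q).2))%MM)
      (fun t m => low (lev t) m /\ A t m)) (free_scale 'X_[m] (e_ s)).
  by move=> s m; apply: (red n.+1) => j; have := ltn_ord j; lia.
(* The terms in the variables of index < k, for growing k. *)
elim: k s m => [|k IHk] s m mk Am.
  apply: (spanned_monom _ (t := inr s)); split=> // j _; exact: mk.
case: (ltnP k n.+1) => [lt_kn|le_nk]; last first.
  by apply: IHk => // j; have := ltn_ord j; lia.
pose i := Ordinal lt_kn.
(* Inside, induction on the exponent of the variable of index k. *)
have [e Ee] : exists e, m i = e by exists (m i).
elim: e s m mk Am Ee => [|e IHe] s m mk Am Ee.
  apply: IHk => // j; rewrite leq_eqVlt => /orP[/eqP kj|/mk //].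
  by rewrite -Ee; congr (m _); apply/val_inj.
have [le_ks|lt_sk] := leqP k (lev s).
  apply: (spanned_monom _ (t := inr s)); split=> // j js.
  by apply: mk; lia.
pose m' := (m - U_(i))%MM.
have Em : m = (m' + U_(i))%MM by apply: subm_addU; rewrite Ee.
have m'k : low k m'.
  by move=> j kj; have := mk j kj; rewrite {1}Em mnmDE; lia.
have m'i : m' i = e by move: Ee; rewrite {1}Em mnmDE mnm1E eqxx; lia.
pose q : rel_idx := Sub (s, i) lt_sk.
have -> : free_scale 'X_[m] (e_ s) = free_scale 'X_[m'] (rel_syz q)
            + free_scale 'X_[m'] (rel s i).
  by rewrite free_scaleB free_scaleM -mpolyXD -Em subrK.
apply: spannedD.
  by apply: (spanned_monom _ (t := inl q)); split=> //=; rewrite -Em.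
have sp : spanned (fun t => e_ t)
    (fun t p => exists2 p', p' \in msupp (rel s i t) & p = (m' + p')%MM)
    (free_scale 'X_[m'] (rel s i)).
  exists (free_scale 'X_[m'] (rel s i)); last by rewrite free_map_id.
  move=> t p; rewrite ffunE => /msuppM_le /allpairsP[[x y] /=].
  by move=> [/mem_msuppXP <- yt ->]; exists y.
apply: (spanned_trans sp) => t _ [p pt ->].
have Atp : A t (m' + p)%MM by apply: (Acl s i); rewrite // -Em.
have p_low := @rel_low s i lt_sk t p pt.
have [le_kt|lt_tk] := leqP k (lev t).
  apply: (spanned_monom _ (t := inr t)); split=> //; apply: low_add => //.
  exact: low_le m'k.
apply: IHe => //.
- by move=> j kj; rewrite mnmDE m'k // p_low //; lia.
- by rewrite mnmDE m'i p_low ?addn0.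
Qed.

End Relations.

(** * Linear systems and their resolutions *)

Record linear_system := LinearSystem {
  base : finType;
  gens : finType;
  level : gens -> nat;
  gen : gens -> {ffun base -> R} }.

Definition mult_linear (M : linear_system) (s : gens M) (m : mon) : Prop :=
  low (level s) m /\ mdeg m = 1%N.

(** This is what remains of a Pommaret basis generated in a single degree once head
    terms are forgotten: only the levels of the generators matter. *)
Definition is_linear_system (M : linear_system) : Prop :=
  (forall s (i : 'I_n.+1), (level s < i)%N ->
     spanned (@gen M) (@mult_linear M) (free_scale 'X_i (gen s))) /\
  (forall v, supported (fun s => low (@level M s)) v ->
     free_map (@gen M) v = 0 -> v = 0).

Definition linear_rel (M : linear_system) (s : gens M) (i : 'I_n.+1) :
    {ffun gens M -> R} :=
  epsilon (inhabits 0) (fun w => supported (@mult_linear M) w /\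
    free_scale 'X_i (gen s) = free_map (@gen M) w).

(** The head term of the syzygy with index (s, i) is x_i e_s, whence its level i. *)
Definition syz_system (M : linear_system) : linear_system :=
  {| base := gens M; gens := rel_idx (@level M);
     level := fun q => (val q).2;
     gen := rel_syz (@linear_rel M) |}.

Section SyzSystem.
Variables (M : linear_system) (linM : is_linear_system M).
Local Notation rel := (@linear_rel M).
Local Notation S := (rel_syz (lev := @level M) rel).

Lemma linear_relP (s : gens M) (i : 'I_n.+1) : (level s < i)%N ->
  supported (@mult_linear M) (rel s i) /\
  free_scale 'X_i (gen s) = free_map (@gen M) (rel s i).
Proof.
move=> si; suff ex_w : exists w, supported (@mult_linear M) w /\
    free_scale 'X_i (gen s) = free_map (@gen M) w by exact: (epsilon_spec _ _ ex_w).
by have [w Aw Ew] := linM.1 s i si; exists w.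
Qed.

Let relP (s : gens M) (i : 'I_n.+1) (si : (level s < i)%N) := (linear_relP si).1.

Let rel_low (s : gens M) (i : 'I_n.+1) (si : (level s < i)%N) :
  supported (fun t => low (@level M t)) (rel s i).
Proof. by move=> t m /(relP si)[]. Qed.

Lemma rel_syz_ker q : free_map (@gen M) (S q) = 0.
Proof.
rewrite free_mapD free_mapN free_map_scale free_map_basis.
by rewrite -(linear_relP (valP q)).2 subrr.
Qed.

(** The normal form of an element of the kernel is a relation with multiplicative
    coefficients, hence zero: only the syzygy part remains. *)
Lemma syz_spanned (A : gens M -> mon -> Prop) (v : {ffun gens M -> R}) :
  (forall s (i : 'I_n.+1) (m : mon) t p, (level s < i)%N -> A s (m + U_(i))%MM ->
     p \in msupp (rel s i t) -> A t (m + p)%MM) ->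
  supported A v -> free_map (@gen M) v = 0 ->
  spanned S (fun (q : rel_idx _) m =>
    low (val q).2 m /\ A (val q).1 (m + U_((val q).2))%MM) v.
Proof.
move=> Acl Av v0.
have [f1 [f2 [Ev S1 [w Aw Ew]]]] := top_variable_reduction rel_low Acl Av.
suff f20 : f2 = 0 by rewrite Ev f20 addr0.
rewrite free_map_id in Ew; apply: linM.2; first by rewrite Ew => t m /Aw[].
move: v0; rewrite Ev free_mapD; case: S1 => w1 _ ->.
by rewrite free_map_ker ?add0r //; exact: rel_syz_ker.
Qed.

Lemma rel_syz_exact v :
  free_map (@gen M) v = 0 <-> exists w, v = free_map S w.
Proof.
split=> [v0|[w ->]]; last first.
  exact/free_map_ker/rel_syz_ker.
have [//|//|w _ Ew] := @syz_spanned (fun _ _ => True) v _ _ v0.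
by exists w.
Qed.

Lemma rel_syz_linear q t m : m \in msupp (S q t) -> mdeg m = 1%N.
Proof.
rewrite !ffunE => /msuppB_le; rewrite mem_cat => /orP[|]; last first.
  by move/(relP (valP q)) => [].
case: eqP => _; last by rewrite mulr0 msupp0.
by rewrite mulr1 => /mem_msuppXP <-; rewrite mdeg1.
Qed.

(** The heads m x_i e_s, with m in the variables up to x_i, are the
    non-multiplicative terms, each obtained once, as i is the index of its
    largest variable.  Let m' x_k e_t, with k at most the level of t, come from the
    tail of m' S, S of level i', and be at the same time a head with largest
    variable x_i.  Then k < i, so x_i divides m' and i <= i'.  Hence the head of
    m' S, which has x_i' in place of x_k, is heavier when x_j weighs j. *)
Lemma rel_syz_independent (v : {ffun rel_idx (@level M) -> R}) :
  supported (fun q : rel_idx _ => low (val q).2) v -> free_map S v = 0 -> v = 0.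
Proof.
move=> v_low; pose w (m : mon) := (\sum_j m j * j)%N.
have wD m m' : w (m + m')%MM = (w m + w m')%N.
  by rewrite /w -big_split; apply: eq_bigr => j _; rewrite mnmDE mulnDl.
have w1 i : w U_(i)%MM = i.
  rewrite /w (bigD1 i) //= mnm1E eqxx mul1n big1 ?addn0 // => j.
  by rewrite mnm1E eq_sym => /negPf ->.
apply: (@triangular_independent _ _ _ (fun q : rel_idx _ => U_((val q).2))%MM
          (fun q : rel_idx _ => (val q).1)
          (fun (q : rel_idx _) m => w m + (val q).2)%N).
- move=> [[s i] si] [[s' i'] si'] m m' /= /v_low mi /v_low mi' Es E.
  rewrite /= in mi mi'.
  apply/val_inj => /=; rewrite Es; congr pair; apply/val_inj => /=.
  have := congr1 (fun m : mon => m i) E; have := congr1 (fun m : mon => m i') E.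
  rewrite !mnmDE !mnm1E !eqxx.
  have [lt_ii|lt_ii|//] := ltngtP (i : nat) (i' : nat).
  + have /negPf ne : i != i' by apply/eqP => E2; rewrite E2 ltnn in lt_ii.
    rewrite (mi i') // ne /=; lia.
  + have /negPf ne : i' != i by apply/eqP => E2; rewrite E2 ltnn in lt_ii.
    rewrite (mi' i) // ne /=; lia.
- move=> [[s i] si] [[s' i'] si'] m m' e /= /v_low mi /v_low mi'.
  rewrite /= in mi mi'.
  rewrite !ffunE /= mulrC addrAC subrr add0r => e_supp E.
  move: e_supp; rewrite (perm_mem (msuppN _)) => e_supp.
  have [e_low /eqP/mdeg1P[k /eqP Ek]] := relP si' e_supp; subst e.
  have le_ks : (k <= level s)%N.
    rewrite leqNgt; apply/negP => /e_low; rewrite mnm1E eqxx; lia.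
  have ki : k != i by apply/eqP => Eki; move: si le_ks; rewrite Eki /=; lia.
  have le_ii' : (i <= i')%N.
    rewrite leqNgt; apply/negP => /mi' m'i.
    have := congr1 (fun m : mon => m i) E.
    by rewrite !mnmDE !mnm1E eqxx (negPf ki) m'i; lia.
  have := congr1 w E; rewrite !wD !w1 => ->.
  rewrite ltn_add2l; move: si le_ks => /=; lia.
Qed.

(** x_j S is a syzygy with entries of degree 2, so its rewriting in terms of the
    generating syzygies, which preserves degrees, has linear coefficients. *)
Lemma syz_system_linear : is_linear_system (syz_system M).
Proof.
split=> [q j _|v]; last exact: rel_syz_independent.
pose v := free_scale 'X_j (S q).
have v2 : supported (fun _ m => mdeg m = 2%N) v.
  move=> t m; rewrite ffunE => /msuppM_le /allpairsP[[x y] /=].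
  by move=> [/mem_msuppXP <- /rel_syz_linear yt ->]; rewrite mdegD mdeg1 yt.
have v0 : free_map (@gen M) v = 0.
  rewrite free_map_scale rel_syz_ker; apply/ffunP=> b.
  by rewrite !ffunE mulr0.
have [|w Aw Ew] := syz_spanned _ v2 v0.
  move=> s i m t p si E /(relP si)[_ p1].
  by move: E; rewrite !mdegD p1 mdeg1.
exists w => // q' m /Aw[ml]; rewrite mdegD mdeg1 => E; split=> //; lia.
Qed.

End SyzSystem.

(** All entries of the differentials have degree 1, so linearity and minimality
    are automatic. *)
Lemma linear_resolution_of_system (T : finType) (lev : T -> nat) (g : T -> R)
    (d : nat) (I : R -> Prop) :
  is_linear_system {| level := lev; gen := fun t => [ffun _ : unit => g t] |} ->
  (forall t, g t \is d.-homog) ->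
  (forall f, I f <-> exists v : {ffun T -> R}, f = \sum_t v t * g t) ->
  has_linear_resolution d I.
Proof.
set M := LinearSystem _ _ => linM g_homog I_gen.
pose chain i := iter i syz_system M.
have chain_lin i : is_linear_system (chain i).
  by elim: i => [//|i IHi]; exact: syz_system_linear.
pose C := @FreeComplex K n (fun i => gens (chain i)) (fun i _ => (i + d)%N) g
  (fun i => @gen (chain i.+1)).
have linC i (b : gbasis C i.+1) (a : gbasis C i) m :
    m \in msupp (gdiff b a) -> mdeg m = 1%N.
  exact: rel_syz_linear.
exists C; split.
- by split=> [b|i b a m /linC ->]; [exact: g_homog|].
- split=> [//|v|i v]; last exact: (rel_syz_exact (chain_lin i.+1)).
  rewrite -(rel_syz_exact (chain_lin 0%N)); split=> [v0|/ffunP/(_ tt)].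
    apply/ffunP=> -[]; rewrite !ffunE -[RHS]v0.
    by apply: eq_bigr => t _; rewrite ffunE.
  rewrite !ffunE => v0; rewrite -[RHS]v0.
  by apply: eq_bigr => t _; rewrite ffunE.
- move=> i b a c c0 E; have := @linC i b a 0%MM.
  by rewrite E msuppC (negPf c0) mem_head mdeg0 => /(_ isT).
- move=> i j /eqP; rewrite -lt0n => /card_gt0P[b].
  by rewrite inE /= => /eqP.
Qed.

(** * Pommaret cones *)

Section MonomialLevel.
Implicit Types (a b m : mon).

(** The term 1 gets the level n, all variables being multiplicative for it. *)
Definition mlevel a : nat := if min_var a is Some k then val k else n.

Lemma nonmultE a i : nonmult a i = (mlevel a < i)%N.
Proof.
rewrite /nonmult /mlevel; case: min_var => [//|].
by apply/esym/negbTE; rewrite -leqNgt -ltnS.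
Qed.

Lemma first_variable a : a <> 0%MM ->
  exists2 k : 'I_n.+1, a k != 0%N & forall j : 'I_n.+1, (j < k)%N -> a j = 0%N.
Proof.
move=> a0; have [i0 i0P] : exists i, a i != 0%N.
  apply/existsP; rewrite -negb_forall; apply/negP => /forallP E.
  by apply/a0/mnmP => j; rewrite mnm0E; apply/eqP.
case: (@arg_minnP _ i0 (fun i => a i != 0%N) (fun i => val i) i0P) => k ak mink.
exists k => // j jk; apply/eqP; apply: contraLR jk => aj.
by rewrite -leqNgt; exact: mink.
Qed.

Lemma mlevel_min a (j : 'I_n.+1) : (j < mlevel a)%N -> a j = 0%N.
Proof.
rewrite /mlevel /min_var; case: pickP => [k /andP[_ /forallP a0] jk|noa _].
  by apply/eqP/(implyP (a0 j)).
case: (eqVneq a 0%MM) => [->|/eqP/first_variable[k ak a0]]; first by rewrite mnm0E.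
have := noa k; rewrite ak /= => /negbT/negP[].
by apply/forallP => l; apply/implyP => /a0 ->.
Qed.

Lemma le_mlevel (k : nat) a :
  (k <= n)%N -> (forall j : 'I_n.+1, (j < k)%N -> a j = 0%N) -> (k <= mlevel a)%N.
Proof.
move=> kn ak; rewrite /mlevel /min_var; case: pickP => [i /andP[ai _]|//].
by rewrite leqNgt; apply: contra ai => /ak ->.
Qed.

Lemma mlevel_le_n a : (mlevel a <= n)%N.
Proof. by rewrite /mlevel; case: min_var => [k|//]; exact: (ltn_ord k). Qed.

Lemma mlevel_addr a b : (mlevel (a + b) <= mlevel b)%N.
Proof.
apply: le_mlevel (mlevel_le_n _) _ => j /mlevel_min.
by rewrite mnmDE; lia.
Qed.

Lemma in_coneP a m : in_cone a (m + a)%MM <-> low (mlevel a) m.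
Proof.
split=> [[m' [m'a /addIm ->]] j|am].
  by rewrite -nonmultE; exact: m'a.
by exists m; split=> // j; rewrite nonmultE; exact: am.
Qed.

Lemma last_difference a b : a <> b -> exists i : 'I_n.+1,
  a i <> b i /\ forall j : 'I_n.+1, (i < j)%N -> a j = b j.
Proof.
move=> ab; have [i0 i0P] : exists i, a i != b i.
  by apply/existsP; rewrite -negb_forall; apply/negP => /forallP E;
     apply/ab/mnmP => j; apply/eqP.
case: (@arg_maxnP _ i0 (fun i => a i != b i) (fun i => val i) i0P) => i /eqP abi maxi.
exists i; split=> // j ij; apply/eqP; apply: contraLR ij => abj.
by rewrite -leqNgt; exact: maxi.
Qed.

(** Reading the exponents as digits in base B encodes, on terms with exponents < B,
    the lexicographic order with the largest variable first as an order of
    natural numbers. *)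
Definition lexwt (B : nat) a : nat := (\sum_j a j * B ^ j)%N.

Lemma lexwt_lt B a b (i : 'I_n.+1) :
  (forall j, a j < B)%N -> (forall j : 'I_n.+1, (i < j)%N -> a j = b j) ->
  (a i < b i)%N -> (lexwt B a < lexwt B b)%N.
Proof.
move=> aB ab abi; rewrite /lexwt.
have small h : (\sum_(j : 'I_n.+1 | (j < h)%N) a j * B ^ j < B ^ h)%N.
  have B0 : (0 < B)%N := leq_ltn_trans (leq0n _) (aB i).
  elim: h => [|h IHh]; first by rewrite big_pred0 // => j; rewrite ltn0.
  have [lt_hn|le_nh] := ltnP h n.+1; last first.
    rewrite (eq_bigl (fun j : 'I_n.+1 => (j < h)%N)).
      by apply: leq_trans IHh _; rewrite leq_pexp2l.
    by move=> j; have := ltn_ord j; lia.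
  rewrite (bigD1 (Ordinal lt_hn)) //= (eq_bigl (fun j : 'I_n.+1 => (j < h)%N)).
    have := leq_mul (aB (Ordinal lt_hn)) (leqnn (B ^ h)).
    rewrite mulSn -expnS => le_h; apply: leq_trans le_h.
    by rewrite addnC ltn_add2r.
  by move=> j; rewrite -val_eqE /=; lia.
have cut (c : mon) : (\sum_j c j * B ^ j = \sum_(j : 'I_n.+1 | (j < i)%N) c j * B ^ j
    + c i * B ^ i + \sum_(j : 'I_n.+1 | (i < j)%N) c j * B ^ j)%N.
  rewrite (bigID (fun j : 'I_n.+1 => (j < i)%N)) /= -addnA; congr addn.
  rewrite (bigD1 i) /= ?ltnn //; congr addn.
  by apply: eq_bigl => j; rewrite -val_eqE /=; lia.
rewrite (cut a) (cut b) (eq_bigr (fun j : 'I_n.+1 => b j * B ^ j)%N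
  (P := fun j : 'I_n.+1 => (i < j)%N)).
  rewrite ltn_add2r; apply: leq_trans (leq_addl _ _).
  apply: leq_trans (leq_mul abi (leqnn (B ^ i))).
  by rewrite mulSn -addSn leq_add2r; exact: small.
by move=> j /ab ->.
Qed.

(** At the last index i where a and b differ, say with a_i < b_i, the variable x_i
    has to divide m, so it is multiplicative for a and a involves no smaller
    variable; but then deg a < deg b. *)
Lemma cone_same_degree a b m m' : mdeg a = mdeg b ->
  low (mlevel a) m -> low (mlevel b) m' -> (m + a = m' + b)%MM -> a = b.
Proof.
wlog : a b m m' / exists i : 'I_n.+1,
    (a i < b i)%N /\ forall j : 'I_n.+1, (i < j)%N -> a j = b j.
  move=> W dab am bm E; apply: NNPP => ab.
  have [i [/eqP abi top]] := last_difference ab.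
  move: abi; rewrite neq_ltn => /orP[lt|lt]; apply: ab.
    by apply: (W a b m m') => //; exists i.
  apply/esym/(W b a m' m) => //; exists i; split=> // j /top //.
move=> [i [lt top]] dab am _ E.
have im : (i <= mlevel a)%N.
  rewrite leqNgt; apply/negP => /am mi0.
  by have := congr1 (fun m : mon => m i) E; rewrite !mnmDE mi0; lia.
suff : (mdeg a < mdeg b)%N by rewrite dab ltnn.
rewrite !mdegE (bigD1 i) // [ltnRHS](bigD1 i) //= -addSn leq_add //.
apply: leq_sum => j ji; have [/top -> //|] := ltnP i j.
rewrite leq_eqVlt val_eqE (negPf ji) => /= lt_ji.
by rewrite mlevel_min //; lia.
Qed.

(** At the last index i where m and m' differ, m_i < m'_i would make x_i
    multiplicative for b; then b involves no variable below x_i, and comparing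
    exponents b divides e, contrary to the hypothesis. *)
Lemma tail_lexwt_lt B b m m' e : (forall j, m' j < B)%N ->
  low (mlevel b) m' -> ~ (b <= e)%MM -> (m + e = m' + b)%MM ->
  (lexwt B m' < lexwt B m)%N.
Proof.
move=> m'B bm' be E; have E_ j : (m j + e j = m' j + b j)%N.
  by rewrite -!mnmDE E.
have mm' : m <> m'.
  by move=> Em; apply: be; apply/mnm_lepP => j; have := E_ j; rewrite Em; lia.
have [i [/eqP mi top]] := last_difference mm'.
move: mi; rewrite neq_ltn => /orP[lt|lt]; last first.
  by apply: lexwt_lt lt => // j /top.
case: be; apply/mnm_lepP => j; have [ij|ji] := leqP i j.
  have := E_ j; move: ij; rewrite leq_eqVlt => /orP[/eqP ij|/top ->]; last by lia.
  by rewrite (_ : j = i); [lia|apply/val_inj].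
suff -> : b j = 0%N by [].
apply: mlevel_min; apply: leq_trans ji _.
by rewrite leqNgt; apply/negP => /bm'; lia.
Qed.

End MonomialLevel.

(** * Writings with respect to a marked basis *)

Section IdealGen.
Variable G : R -> Prop.

Lemma ideal_gen_mem f : G f -> ideal_gen G f.
Proof.
move=> Gf; exists [:: (1, f)]; split=> [q|]; last by rewrite big_seq1 mul1r.
by rewrite inE => /eqP ->.
Qed.

Lemma ideal_gen0 : ideal_gen G 0.
Proof. by exists [::]; rewrite big_nil. Qed.

Lemma ideal_genD f h : ideal_gen G f -> ideal_gen G h -> ideal_gen G (f + h).
Proof.
move=> [s [Gs ->]] [t [Gt ->]]; exists (s ++ t); rewrite big_cat; split=> // q.
by rewrite mem_cat => /orP[/Gs|/Gt].
Qed.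

Lemma ideal_genM p f : ideal_gen G f -> ideal_gen G (p * f).
Proof.
move=> [s [Gs ->]]; exists [seq (p * q.1, q.2) | q <- s]; split.
  by move=> q /mapP[q' /Gs Gq' ->].
by rewrite big_map mulr_sumr; apply: eq_bigr => q _; rewrite mulrA.
Qed.

Lemma ideal_gen_sum (T : finType) (v h : T -> R) :
  (forall t, ideal_gen G (h t)) -> ideal_gen G (\sum_t v t * h t).
Proof.
move=> Gh; elim/big_ind: _ => [||t _]; [exact: ideal_gen0|exact: ideal_genD|].
exact: ideal_genM.
Qed.

Lemma ideal_gen_min (I : R -> Prop) f :
  I 0 -> (forall f h, I f -> I h -> I (f + h)) -> (forall p f, I f -> I (p * f)) ->
  (forall h, G h -> I h) -> ideal_gen G f -> I f.
Proof.
move=> I0 ID IM GI [s [Gs ->]]; rewrite big_seq; elim/big_ind: _ => // q qs.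
exact/IM/GI/Gs.
Qed.

End IdealGen.

Lemma sum_unit (h : unit -> R) : \sum_t h t = h tt.
Proof. by apply: big_pred1 => -[]. Qed.

Section Marked.
Variables (J : R -> Prop) (P : {fset mon}) (F : P -> R).
Hypotheses (P_basis : pommaret_basis J P) (F_marked : marked_basis J F).
Implicit Types (a b : P) (m : mon).

Local Notation vecF := (fun a => [ffun _ : unit => F a]).
Local Notation lowP := (fun a m => low (mlevel (val a)) m).

Lemma not_divides_outside b e : ~ J 'X_[e] -> ~ (val b <= e)%MM.
Proof.
have [J_gen _ _] := P_basis => Je be; apply: Je; apply/J_gen.
rewrite -(submK be) mpolyXD; apply/ideal_genM/ideal_gen_mem.
by exists (val b) => //; exact: valP.
Qed.

Lemma cones_disjoint a b m m' : low (mlevel (val a)) m ->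
  low (mlevel (val b)) m' -> (m + val a = m' + val b)%MM -> a = b.
Proof.
have [_ _ disj] := P_basis => /in_coneP am /in_coneP bm E.
by apply/val_inj; apply: disj am _; rewrite ?E //; exact: valP.
Qed.

Lemma J_term_cone m : J 'X_[m] ->
  exists a m', low (mlevel (val a)) m' /\ m = (m' + val a)%MM.
Proof.
have [_ J_cone _] := P_basis => /J_cone[a aP [m' [am Em]]].
exists [` aP]%fset, m'; split=> // j; rewrite -nonmultE; exact: am.
Qed.

Lemma tail_outside a e : e \in msupp (F a - 'X_[val a]) -> ~ J 'X_[e].
Proof. by have [F_set _ _] := F_marked; have [_ _] := F_set a; exact. Qed.

Lemma F_homog a : F a \is (mdeg (val a)).-homog.
Proof.
have [F_set _ _] := F_marked; have [[d Fd] Fa _] := F_set a.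
have /(dhomog_mf Fd) Ed : val a \in msupp (F a).
  by rewrite mcoeff_msupp Fa oner_eq0.
by move: Fd; rewrite -Ed.
Qed.

Lemma tail_homog a e : e \in msupp (F a - 'X_[val a]) -> mdeg e = mdeg (val a).
Proof.
move/msuppB_le; rewrite mem_cat => /orP[/(dhomog_mf (F_homog a)) //|].
by move/mem_msuppXP => ->.
Qed.

(** Uniqueness of writings: heads lie in disjoint cones, and when a term of a tail
    falls into the cone of some b, its multiplier there is lexicographically
    smaller. *)
Lemma marked_independent (v : {ffun P -> R}) :
  supported lowP v -> free_map vecF v = 0 -> v = 0.
Proof.
move=> v_low; pose B := \max_a msize (v a).
have lt_B a m j : m \in msupp (v a) -> (m j < B)%N.
  move=> ma; apply: leq_trans (leq_bigmax a).
  apply: leq_ltn_trans (msize_mdeg_lt ma).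
  by rewrite mdegE (bigD1 j) //= leq_addr.
apply: (@triangular_independent _ _ _ (fun a => val a) (fun=> tt)
          (fun _ m => lexwt B m)).
- by move=> a b m m' /v_low am /v_low bm _; exact: cones_disjoint.
- move=> a b m m' e ma mb; rewrite ffunE eqxx mul1r => /tail_outside Je E.
  apply: (tail_lexwt_lt (b := val a) (e := e)).
  + by move=> j; exact: lt_B ma.
  + exact: v_low ma.
  + exact: not_divides_outside.
  + by rewrite E.
Qed.

(** A term of J is replaced by the corresponding multiple of F and its tail; the
    multipliers of the tail terms lying in J are lexicographically smaller, and
    they are of bounded degree, so this stops. *)
Lemma marked_normal_form D (f : R) : f \is D.-homog ->
  exists v h, [/\ supported (fun a m => low (mlevel (val a)) m
                                 /\ (mdeg m + mdeg (val a) = D)%N) v,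
                  f = \sum_a v a * F a + h & supp_outside J h].
Proof.
move=> fD.
pose A1 a m := low (mlevel (val a)) m /\ (mdeg m + mdeg (val a) = D)%N.
pose A2 (_ : unit) (m : mon) := ~ J 'X_[m].
pose one (_ : unit) : {ffun unit -> R} := [ffun=> 1].
suff red : forall m, mdeg m = D ->
    spanned (sum_family vecF one) (sum_cond A1 A2) [ffun _ : unit => 'X_[m]].
  have sf : spanned one (fun _ m => mdeg m = D) [ffun _ : unit => f].
    exists [ffun _ : unit => f].
      by move=> t m; rewrite ffunE => /(dhomog_mf fD).
    by apply/ffunP=> -[]; rewrite !ffunE sum_unit !ffunE mulr1.
  have {sf} : spanned (sum_family vecF one) (sum_cond A1 A2) [ffun _ : unit => f].
    apply: (spanned_trans sf) => t m /red; congr spanned.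
    by apply/ffunP=> s; rewrite !ffunE mulr1.
  case/spanned_sum_family => f1 [f2 [Ef [v Av E1] [h Ah E2]]].
  exists v, (h tt); split=> // [|m]; last exact: Ah.
  move/ffunP/(_ tt): Ef; rewrite E1 E2 !ffunE => ->.
  congr (_ + _); first by apply: eq_bigr => a _; rewrite ffunE.
  by rewrite sum_unit !ffunE mulr1.
(* Multipliers have degree at most D, so base D.+1 suffices. *)
pose wt := lexwt D.+1.
have step N a m' : (wt m' < N)%N -> low (mlevel (val a)) m' ->
    (mdeg m' + mdeg (val a) = D)%N ->
    spanned (sum_family vecF one) (sum_cond A1 A2)
      [ffun _ : unit => 'X_[m' + val a]].
  elim: N a m' => [//|N IHN] a m' wtN am degm.
  have -> : [ffun _ : unit => 'X_[m' + val a]] = free_scale 'X_[m'] (vecF a)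
      + (-1) *: [ffun _ : unit => 'X_[m'] * (F a - 'X_[val a])] :> {ffun unit -> R}.
    apply/ffunP => t; rewrite !ffunE scaleN1r -mulrN -mulrDr opprB addrC subrK.
    by rewrite mpolyXD.
  apply: spannedD; first exact: (spanned_monom _ (t := inl a)).
  apply: spannedZ; have st : spanned one
      (fun _ m => exists2 e, e \in msupp (F a - 'X_[val a]) & m = (m' + e)%MM)
      [ffun _ : unit => 'X_[m'] * (F a - 'X_[val a])].
    exists [ffun _ : unit => 'X_[m'] * (F a - 'X_[val a])].
      move=> t m; rewrite ffunE => /msuppM_le /allpairsP[[x y] /=].
      by move=> [/mem_msuppXP <- yt ->]; exists y.
    by apply/ffunP=> -[]; rewrite !ffunE sum_unit !ffunE mulr1.
  apply: (spanned_trans st) => t _ [e et ->].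
  case: (classic (J 'X_[m' + e])) => [Je|nJe]; last first.
    exact: (spanned_monom _ (t := inr tt)).
  have [b [m'' [bm'' E]]] := J_term_cone Je.
  have -> : free_scale 'X_[m' + e] (one t) = [ffun _ : unit => 'X_[m'' + val b]].
    by apply/ffunP=> s; rewrite !ffunE mulr1 E.
  have degE : (mdeg m'' + mdeg (val b) = D)%N.
    by rewrite -mdegD -E mdegD (tail_homog et).
  apply: IHN => //; rewrite ltnS in wtN; apply: leq_trans wtN.
  apply: (tail_lexwt_lt (b := val b) (e := e)) => //.
  - move=> j; rewrite ltnS -degE mdegE (bigD1 j) //= -addnA leq_addr //.
  - exact/not_divides_outside/(tail_outside et).
move=> m mD; case: (classic (J 'X_[m])) => [Jm|nJm].
  have [a [m' [am Em]]] := J_term_cone Jm; rewrite Em.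
  by apply: (step (wt m').+1) => //; rewrite -mdegD -Em.
have -> : [ffun _ : unit => 'X_[m]] = free_scale 'X_[m] (one tt) :> {ffun unit -> R}.
  by apply/ffunP=> t; rewrite !ffunE mulr1.
exact: (spanned_monom _ (t := inr tt)).
Qed.

Lemma marked_writing D (f : R) : f \is D.-homog -> ideal_of F f ->
  exists2 v, supported (fun a m => low (mlevel (val a)) m
                                 /\ (mdeg m + mdeg (val a) = D)%N) v
           & f = \sum_a v a * F a.
Proof.
move=> fD If; have [v [h [Av Ef Jh]]] := marked_normal_form fD.
exists v => //; rewrite Ef; set g := \sum_a _ in Ef *.
suff -> : h = 0 by rewrite addr0.
have [_ _ trivial] := F_marked.
have Eh : h = f + (-1) * g by rewrite Ef mulN1r addrC addKr.
apply: (trivial D) => //.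
- rewrite Eh mulN1r rpredB // rpred_sum // => a _; apply/dhomogP => m.
  move=> /msuppM_le/allpairsP[[x y] /= [/Av[_ Ex] /(dhomog_mf (F_homog a)) Ey ->]].
  by rewrite mdegD Ey Ex.
- rewrite Eh; apply/ideal_genD/ideal_genM/ideal_gen_sum => // a.
  by apply: ideal_gen_mem; exists a.
Qed.

(** The writing chosen by [epsilon] has no homogeneity built in; it is inherited
    from the one that [marked_writing] constructs. *)
Lemma writing_unique (f : {ffun unit -> R}) (v : {ffun P -> R}) :
  supported lowP v -> f = free_map vecF v -> @writing K n (family_of F) f = v.
Proof.
move=> v_low Ef.
have : @is_writing K n (family_of F) f (@writing K n (family_of F) f).
  apply: epsilon_spec; exists v; split=> // a m /v_low am.
  exact/in_coneP.
set w := @writing _ _ _ _ => -[Ew w_low].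
apply/eqP; rewrite -subr_eq0; apply/eqP/marked_independent.
  move=> a m; rewrite !ffunE => /msuppB_le; rewrite mem_cat => /orP[/w_low|/v_low //].
  by move/in_coneP.
rewrite free_mapD free_mapN -Ef; apply/eqP; rewrite subr_eq0; apply/eqP.
exact/esym/Ew.
Qed.

Definition marked_rel a (i : 'I_n.+1) : {ffun P -> R} :=
  @writing K n (family_of F) (free_scale 'X_i (vecF a)).

(** * Consequences of minimality *)

Hypothesis F_minimal : U_res_minimal F.

(** The coefficient of F b in the writing of x_i F a is homogeneous of degree
    deg a + 1 - deg b.  If deg b > deg a it is therefore a constant, and minus
    that constant is an entry of the first differential. *)
Lemma marked_relP a (i : 'I_n.+1) : (mlevel (val a) < i)%N ->
  supported (fun b m => [/\ low (mlevel (val b)) m,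
      (mdeg m + mdeg (val b) = (mdeg (val a)).+1)%N
      & (mdeg (val b) <= mdeg (val a))%N]) (marked_rel a i)
  /\ free_scale 'X_i (vecF a) = free_map vecF (marked_rel a i).
Proof.
move=> ai; have XF_homog : 'X_i * F a \is ((mdeg (val a)).+1).-homog.
  by rewrite -[(mdeg _).+1]add1n; apply: dhomogM (F_homog a); rewrite dhomogX /= mdeg1.
have XF_ideal : ideal_of F ('X_i * F a).
  by apply/ideal_genM/ideal_gen_mem; exists a.
have [v Av Ev] := marked_writing XF_homog XF_ideal.
have Evec : free_scale 'X_i (vecF a) = free_map vecF v.
  apply/ffunP=> t; rewrite !ffunE Ev.
  by apply: eq_bigr => b _; rewrite ffunE.
have -> : marked_rel a i = v by apply: writing_unique Evec => b m /Av[].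
split=> // b m mb; have [bm degm] := Av b m mb; split=> //.
rewrite leqNgt; apply/negP => lt_ab.
have m0 : m = 0%MM by apply/eqP; rewrite -mdeg_eq0; apply/eqP; lia.
have degb : mdeg (val b) = (mdeg (val a)).+1 by move: degm; rewrite m0 mdeg0.
have ab : a != b by apply/eqP => E; move: lt_ab; rewrite E ltnn.
have vb : v b = ((v b)@_0%MM)%:MP.
  apply/mpolyP => k; rewrite mcoeffC; case: eqP => [->|k0]; first by rewrite mulr1.
  rewrite mulr0; apply: memN_msupp_eq0; apply/negP => /Av[_].
  rewrite degb => degk; apply: k0; apply/eqP; rewrite -mdeg_eq0; apply/eqP; lia.
have anm : nonmult (val a) i by rewrite nonmultE.
pose s : idx (U_res F 1) := Sub (a, i) anm.
apply: (@F_minimal 1 isT s b (- (v b)@_0%MM)).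
  by rewrite oppr_eq0 -mcoeff_msupp -m0.
rewrite /= /fund_syz /= !ffunE eq_sym (negPf ab).
rewrite mulr0 add0r mpolyCN -vb; congr (- _).
by rewrite (@writing_unique _ v) // => c k /Av[].
Qed.

(** Since rewriting does not increase the degrees of the generators involved, the
    reduction by the largest variable stays among those of degree at most d. *)
Lemma degree_bounded_span d D a m :
  (mdeg (val a) <= d)%N -> (mdeg m + mdeg (val a) = D)%N ->
  spanned vecF (fun b p => [/\ low (mlevel (val b)) p,
      (mdeg p + mdeg (val b) = D)%N & (mdeg (val b) <= d)%N])
    (free_scale 'X_[m] (vecF a)).
Proof.
move=> ad degm.
pose A b (p : mon) := (mdeg p + mdeg (val b) = D)%N /\ (mdeg (val b) <= d)%N.
have rel_low b (i : 'I_n.+1) : (mlevel (val b) < i)%N ->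
    supported lowP (marked_rel b i).
  by move=> bi c p /((marked_relP bi).1)[].
have Av : supported A (free_scale 'X_[m] (e_ a)).
  move=> b p; rewrite !ffunE; case: eqP => [->|_]; last by rewrite mulr0 msupp0.
  by rewrite mulr1 => /mem_msuppXP <-.
have [|f1 [f2 [Ev [w _ E1] [u Au E2]]]] :=
    top_variable_reduction (lev := fun b : P => mlevel (val b)) rel_low _ Av.
  move=> b i k c p bi [degk bd] /((marked_relP bi).1)[_ degp cb].
  by rewrite /A mdegD; move: degk; rewrite mdegD mdeg1; lia.
exists u; first by move=> b p /Au[? []].
rewrite -(free_map_basis vecF a) -free_map_scale Ev free_mapD E2 free_map_id.
rewrite E1 free_map_ker ?add0r // => q.
rewrite free_mapD free_mapN free_map_scale free_map_basis.
by rewrite (marked_relP (valP q)).2 subrr.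
Qed.

(** * The component of degree d *)

Section Component.
Variable d : nat.

Definition component_idx : finType :=
  {q : P * 'X_{1..n.+1 < d.+1} | (mdeg q.2 + mdeg (val q.1) == d)%N &&
     [forall i : 'I_n.+1, (mlevel (val q.1) < i)%N ==> ((q.2 : mon) i == 0%N)]}.

Definition component_root (q : component_idx) : P := (val q).1.
Definition component_mult (q : component_idx) : mon := (val q).2.

Definition component_gen (q : component_idx) : R :=
  'X_[component_mult q] * F (component_root q).

Definition component_level (q : component_idx) : nat :=
  mlevel (component_mult q + val (component_root q)).

Local Notation vecG := (fun q => [ffun _ : unit => component_gen q]).

Lemma component_idxP b p : low (mlevel (val b)) p ->
  (mdeg p + mdeg (val b) = d)%N ->
  exists q, component_root q = b /\ component_mult q = p.
Proof.
move=> bp degp; have lt_pd : (mdeg p < d.+1)%N by lia.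
have qP : (mdeg (BMultinom lt_pd) + mdeg (val b) == d)%N && [forall i : 'I_n.+1,
    (mlevel (val b) < i)%N ==> ((BMultinom lt_pd : mon) i == 0%N)].
  rewrite /= degp eqxx; apply/forallP => i; apply/implyP => /bp /eqP //.
by exists (Sub (b, BMultinom lt_pd) qP).
Qed.

Lemma component_mult_low q : low (mlevel (val (component_root q))) (component_mult q).
Proof.
have /andP[_ /forallP qP] := valP q.
by move=> i qi; apply/eqP/(implyP (qP i)).
Qed.

Lemma component_deg q : (mdeg (component_mult q) + mdeg (val (component_root q)) = d)%N.
Proof. by have /andP[/eqP] := valP q. Qed.

Lemma vecG_E q : vecG q = free_scale 'X_[component_mult q] (vecF (component_root q)).
Proof. by apply/ffunP=> t; rewrite !ffunE. Qed.

(** Let p f_b be a term in the writing of a multiple of degree d + 1, and x_k the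
    smallest variable of p.  As x_k is multiplicative for b, no smaller variable
    divides (p / x_k) b, so x_k is multiplicative for the product
    (p / x_k) f_b of degree d.  Splitting off any other variable might fail here.
    For the independence, products over one f_b have disjoint cones, as their
    heads have the same degree. *)
Lemma component_linear : is_linear_system
  {| level := component_level; gen := fun q => [ffun _ : unit => component_gen q] |}.
Proof.
split=> [q i _ /=|v /= v_low].
  have qd := component_deg q.
  have -> : free_scale 'X_i (vecG q) = free_scale 'X_[(U_(i) + component_mult q)%MM]
      (vecF (component_root q)).
    by rewrite vecG_E free_scaleM mpolyXD.
  apply: spanned_trans (degree_bounded_span (d := d) (D := d.+1) _ _) _.
  - by rewrite -qd leq_addl.
  - by rewrite mdegD mdeg1 -addnA qd.
  move=> b p [bp degp degb].
  have [|k pk p0] := @first_variable p.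
    by move=> E; move: degp; rewrite E mdeg0; lia.
  have kb : (k <= mlevel (val b))%N.
    by rewrite leqNgt; apply/negP => /bp E; rewrite E in pk.
  have Ep : p = (p - U_(k) + U_(k))%MM by apply: subm_addU; lia.
  have [||r [rb rp]] := @component_idxP b (p - U_(k))%MM.
  - by move=> j /bp; rewrite mnmBE => ->.
  - by move: degp; rewrite {1}Ep mdegD mdeg1; lia.
  have -> : free_scale 'X_[p] (vecF b) = free_scale 'X_k (vecG r).
    by rewrite vecG_E rb rp free_scaleM -mpolyXD addmC -Ep.
  apply: (spanned_monom vecG (t := r)).
  split; rewrite ?mdeg1 //= => j; rewrite /component_level rb rp => lt_j.
  rewrite mnm1E; case: eqP => [kj|//]; move: lt_j; rewrite -kj ltnNge => /negP[].
  apply: le_mlevel => [|l lk]; first by rewrite -ltnS.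
  by rewrite mnmDE mnmBE p0 // (mlevel_min (leq_trans lk kb)).
pose h q := free_scale 'X_[component_mult q] (e_ (component_root q)).
have -> : free_map vecG v = free_map vecF (free_map h v).
  rewrite free_map_comp; apply: eq_free_map => q.
  by rewrite free_map_scale free_map_basis vecG_E.
move=> /(marked_independent _) w0.
have {w0} : free_map h v = 0.
  apply: w0; have hv : spanned h (fun q => low (component_level q)) (free_map h v).
    by exists v.
  suff [w w_low ->] : spanned (fun a => e_ a) lowP (free_map h v).
    by rewrite free_map_id.
  apply: spanned_trans hv _ => q m qm; rewrite free_scaleM -mpolyXD.
  apply: spanned_monom; apply: low_add; last exact: component_mult_low.
  exact: low_le (mlevel_addr _ _) qm.
apply: (@triangular_independent _ _ _ component_mult component_root (fun _ _ => 0%N)).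
- move=> q r m m' /v_low qm /v_low rm Er Em.
  have Eqr : (component_mult q + val (component_root q) =
              component_mult r + val (component_root r))%MM.
    apply: (@cone_same_degree _ _ m m') => //.
    + by rewrite !mdegD !component_deg.
    + by rewrite !addmA Em Er.
  apply/val_inj/injective_projections => //; apply/val_inj => /=.
  by move: Eqr; rewrite Er => /addIm.
- by move=> q r m m' e _ _; rewrite !ffunE mulrC subrr msupp0.
Qed.

Lemma component_generated f :
  ideal_gen (fun g => ideal_of F g /\ g \is d.-homog) f <->
  exists v : {ffun component_idx -> R}, f = \sum_q v q * component_gen q.
Proof.
split=> [|[v ->]]; last first.
  apply: ideal_gen_sum => q; apply: ideal_gen_mem; split.
    by apply/ideal_genM/ideal_gen_mem; exists (component_root q).
  by rewrite -(component_deg q); apply: dhomogM (F_homog _); rewrite dhomogX.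
apply: (@ideal_gen_min _ (fun f => exists v : {ffun component_idx -> R},
    f = \sum_q v q * component_gen q)).
- by exists 0; rewrite big1 // => q _; rewrite ffunE mul0r.
- move=> _ _ [v ->] [w ->]; exists (v + w); rewrite -big_split.
  by apply: eq_bigr => q _; rewrite ffunE mulrDl.
- move=> p _ [v ->]; exists (free_scale p v); rewrite mulr_sumr.
  by apply: eq_bigr => q _; rewrite ffunE mulrA.
move=> g [Fg gd]; have [v Av Eg] := marked_writing gd Fg.
have sg : spanned vecF (fun a m => low (mlevel (val a)) m
    /\ (mdeg m + mdeg (val a) = d)%N) [ffun _ : unit => g].
  exists v => //; apply/ffunP => t; rewrite !ffunE Eg.
  by apply: eq_bigr => a _; rewrite ffunE.
have [|w _ /ffunP/(_ tt)] :=
    @spanned_trans _ _ _ vecG _ _ (fun _ _ => True) _ sg.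
  move=> a m [am degm]; have [q [qa qm]] := component_idxP am degm.
  rewrite (_ : free_scale _ _ = free_scale 'X_[0%MM] (vecG q)).
    exact: (spanned_monom vecG).
  by rewrite mpolyX0 free_scale1 vecG_E qa qm.
rewrite !ffunE => ->; exists w.
by apply: eq_bigr => q _; rewrite ffunE.
Qed.

Lemma component_linear_resolution (I : R -> Prop) :
  (forall f, I f <-> ideal_of F f) ->
  has_linear_resolution d (ideal_gen (fun f => I f /\ f \is d.-homog)).
Proof.
move=> I_gen; apply: linear_resolution_of_system component_linear _ _.
  by move=> q; rewrite -(component_deg q); apply: dhomogM (F_homog _); rewrite dhomogX.
move=> f; rewrite -component_generated.
by split=> -[s [Gs Ef]]; exists s; split=> // q /Gs[/I_gen].
Qed.

End Component.

End Marked.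

End LinearResolutions.

Theorem theorem3p10 (K : fieldType) (n : nat) (J I : {mpoly K[n.+1]} -> Prop)
    (P : {fset 'X_{1..n.+1}}) (F : P -> {mpoly K[n.+1]})
    (J_quasi_stable : quasi_stable J) (P_basis : pommaret_basis J P)
    (F_marked : marked_basis J F)
    (I_gen : forall f, I f <-> ideal_of F f)
    (F_minimal : U_res_minimal F) :
  componentwise_linear I.
Proof. by move=> d; exact: (component_linear_resolution P_basis F_marked). Qed.
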